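(* Let $S$ and $T$ be points on the surface of a cube lying in the (relative) interiors of two opposite faces. Then every shortest path on the surface of the cube from $S$ to $T$ traverses either exactly three or exactly four faces of the cube.
   Context: A shortest path from $S$ to $T$ is a curve lying on the surface of the cube (the boundary of the solid cube) from $S$ to $T$ whose length is minimal among all such curves. The number of faces traversed by a path is the number of faces of the cube whose relative interior meets the path. *)

(* Defs.v *)
From mathcomp Require Import all_boot all_order all_algebra.
From mathcomp Require Import all_classical all_reals all_analysis.
Import Order.TTheory GRing.Theory Num.Theory numFieldNormedType.Exports.
Set Implicit Arguments.
Unset Strict Implicit.
Unset Printing Implicit Defensive.
Local Open Scope classical_set_scope.
Local Open Scope ring_scope.

(* The norm `|_| on 'rV[R]_n is the sup norm, so the Euclidean distance is
   defined here; both induce the same topology. *)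
Definition edist (R : realType) (n : nat) (x y : 'rV[R]_n) : R :=
  Num.sqrt (\sum_j (x 0 j - y 0 j) ^+ 2).

(* An arbitrary cube in R^3: a vertex, an edge length, and an orthonormal
   frame, given by the rows of [cube_frame], for the edges at that vertex. *)
Record cube (R : realType) := Cube {
  cube_vertex : 'rV[R]_3;
  cube_side : R;
  cube_frame : 'M[R]_3;
  cube_side_gt0 : 0 < cube_side;
  cube_frame_orthonormal : cube_frame *m cube_frame^T = 1%:M }.

(* The similarity carrying [0, 1]^3 onto Q. *)
Definition cube_chart (R : realType) (Q : cube R) (u : 'rV[R]_3) : 'rV[R]_3 :=
  cube_vertex Q + cube_side Q *: (u *m cube_frame Q).

Definition solid_cube (R : realType) (Q : cube R) : set 'rV[R]_3 :=
  [set cube_chart Q u | u in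
    [set u : 'rV[R]_3 | forall j : 'I_3, 0 <= u 0 j <= 1]].

Definition cube_surface (R : realType) (Q : cube R) : set 'rV[R]_3 :=
  closure (solid_cube Q) `\` interior (solid_cube Q).

(* The face (i, b) is the one on which the i-th chart coordinate equals b,
   with b read as 0 or 1. *)
Definition cube_face : Type := ('I_3 * bool)%type.

Definition opposite_faces (f g : cube_face) : bool :=
  (f.1 == g.1) && (f.2 != g.2).

Definition face_relint (R : realType) (Q : cube R) (f : cube_face) :
    set 'rV[R]_3 :=
  [set cube_chart Q u | u in [set u : 'rV[R]_3 |
    u 0 f.1 = (f.2 : nat)%:R /\ forall j : 'I_3, j != f.1 -> 0 < u 0 j < 1]].

(* Length of the curve g restricted to [0, 1]: the supremum of the lengths of
   inscribed polygons, +oo if g is not rectifiable. The partition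
   0 = t_0 < ... < t_k = 1 is represented by s = [:: t_1; ...; t_k]. *)
Definition polygon_length (R : realType) (n : nat) (g : R -> 'rV[R]_n)
    (s : seq R) : R :=
  \sum_(0 <= k < size s)
    edist (g (nth 1 (0 :: s) k)) (g (nth 1 (0 :: s) k.+1)).

Definition curve_length (R : realType) (n : nat) (g : R -> 'rV[R]_n) : \bar R :=
  ereal_sup [set (polygon_length g s)%:E | s in itv_partition 0 1].

Definition surface_curve (R : realType) (Q : cube R) (S T : 'rV[R]_3)
    (g : R -> 'rV[R]_3) : Prop :=
  [/\ {within `[0, 1], continuous g},
      (forall t : R, t \in `[0, 1] -> cube_surface Q (g t)),
      g 0 = S & g 1 = T].

Definition shortest_path (R : realType) (Q : cube R) (S T : 'rV[R]_3)
    (g : R -> 'rV[R]_3) : Prop :=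
  surface_curve Q S T g /\
  forall h, surface_curve Q S T h -> (curve_length g <= curve_length h)%E.

Definition traverses (R : realType) (Q : cube R) (g : R -> 'rV[R]_3)
    (f : cube_face) : Prop :=
  exists2 t : R, t \in `[0, 1] & face_relint Q f (g t).

Definition num_faces_traversed (R : realType) (Q : cube R)
    (g : R -> 'rV[R]_3) : nat :=
  #|[pred f : cube_face | `[< traverses Q g f >]]|.

(* Main.v *)
Require Import Defs.
From mathcomp Require Import all_boot all_order all_algebra.
From mathcomp Require Import all_classical all_reals all_analysis.
From mathcomp Require Import ring lra.
Import Order.TTheory GRing.Theory Num.Theory numFieldNormedType.Exports.
Local Open Scope classical_set_scope.
Local Open Scope ring_scope.

(* In the coordinates of the cube let S lie in z = 0 and T in z = 1. The strip
   made of the faces z = 0, y = 0, z = 1 unfolds to the plane, and the segment in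
   it shows that a shortest path has length at most
   sqrt((1 + y(S) + y(T))^2 + (x(S) - x(T))^2); the same holds for the other three
   lateral faces. A path through a point of the edge x = y = 0 and a point of the
   edge x = 1, y = 0 has, already by the triangle inequality in space, length at
   least sqrt((1 + y(S) + y(T))^2 + 1), which is larger. Hence a shortest path
   never touches both vertical edges of a lateral face. As the part of a shortest
   path between two points of the face z = 0 is a segment in that face (likewise
   for z = 1), a path meeting the interiors of both x = 0 and x = 1 stays in
   0 < z < 1 in between and has to cross a lateral face from one vertical edge to
   the other; so at most one of x = 0, x = 1 and at most one of y = 0, y = 1 is
   traversed. If no lateral face is traversed, the path runs along a whole vertical
   edge, which is again too long. *)

(** * Lengths of polygons inscribed in a curve *)

Section PolygonalLength.
Set Implicit Arguments.
Unset Strict Implicit.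
Context {R : realType}.
Implicit Types (d : R -> R -> R) (M a b c r t : R) (l s : seq R).

(** The distance [d] depends on two parameter values instead of two points, so that reversed, partly
    replaced and rescaled curves are all instances. *)
Fixpoint poly_sum d a l : R :=
  if l is b :: l' then d a b + poly_sum d b l' else 0.

(* Allowing repeated nodes and polygons that do not reach the endpoints leaves
   the supremum unchanged and makes partitions easy to refine. *)
Definition length_le d M := forall a l,
  0 <= a -> path <=%O a l -> last a l <= 1 -> poly_sum d a l <= M.

Lemma polygon_length_poly_sum n (g : R -> 'rV[R]_n) s :
  polygon_length g s = poly_sum (fun t t' => Defs.edist (g t) (g t')) 0 s.
Proof.
pose e t t' := Defs.edist (g t) (g t').
suff /(_ 0)/esym : forall a, poly_sum e a s =
    \sum_(0 <= k < size s) e (nth 1 (a :: s) k) (nth 1 (a :: s) k.+1) by [].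
elim: s => [|b s IH] a; first by rewrite big_nil.
by rewrite [size _]/= big_nat_recl //= -IH.
Qed.

(** A weakly increasing polygon refines to a partition: 0 is put in front, 1 at the end if missing,
    and repeated nodes are dropped. This never shortens it, as [d] is nonnegative and vanishes on
    the diagonal. *)
Lemma length_le_partition d M :
    (forall a, d a a = 0) -> (forall a b, 0 <= d a b) ->
  (forall s, itv_partition 0 1 s -> poly_sum d 0 s <= M) -> length_le d M.
Proof.
move=> d0 dge0 dM a l a0 al l1.
suff refine a' l' : path <=%O a' l' -> last a' l' <= 1 ->
    exists s, [/\ path <%O a' s, last a' s = 1 & poly_sum d a' l' <= poly_sum d a' s].
  have [||s [s0 s1 ls]] := refine 0 (a :: l); rewrite /= ?a0 //.
  apply: le_trans (dM s _); last by split => //; apply/eqP.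
  by apply: le_trans ls; rewrite /= lerDr.
elim: l' a' => [|b l' IH] a' /=.
  move=> _; rewrite le_eqVlt => /orP[/eqP ->|a1]; first by exists [::].
  by exists [:: 1]; rewrite /= a1 addr0.
move=> /andP[ab bl] l1'; have [s [bs s1 ls]] := IH b bl l1'.
move: ab; rewrite le_eqVlt => /orP[/eqP ->|ab]; first by exists s; rewrite d0 add0r.
by exists (b :: s); rewrite /= ab lerD2l.
Qed.

Lemma partition_length_le d M s :
  length_le d M -> itv_partition 0 1 s -> poly_sum d 0 s <= M.
Proof.
move=> dM [s0 /eqP s1]; apply: dM => //; last by rewrite s1.
by apply: sub_path s0 => x y /ltW.
Qed.

Lemma path_le_last a l : path <=%O a l -> a <= last a l.
Proof. by elim: l a => //= b l IH a /andP[ab /IH]; exact: le_trans. Qed.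

Lemma length_le_lipschitz d D : 0 <= D ->
  (forall t t', 0 <= t -> t <= t' -> t' <= 1 -> d t t' <= (t' - t) * D) ->
  length_le d D.
Proof.
move=> D0 dD a l a0 al l1.
suff : poly_sum d a l <= (1 - a) * D.
  by move/le_trans; apply; rewrite -[leRHS]mul1r ler_wpM2r //; lra.
elim: l a a0 al l1 => [|b l IH] a a0 /=.
  by move=> _ a1; rewrite mulr_ge0 //; lra.
move=> /andP[ab bl] l1; have b0 := le_trans a0 ab.
have b1 := le_trans (path_le_last bl) l1.
have := IH b b0 bl l1; have := dD a b a0 ab b1; lra.
Qed.

Lemma length_le_rev d M : (forall a b, d a b = d b a) ->
  length_le d M -> length_le (fun t t' => d (1 - t) (1 - t')) M.
Proof.
move=> dC dM a l a0 al l1.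
suff : poly_sum (fun t t' => d (1 - t) (1 - t')) a l + poly_sum d (1 - a) [::] <= M.
  by rewrite /= addr0.
have : last (1 - a) [::] <= 1 by rewrite /=; lra.
have : path <=%O (1 - a) [::] by [].
(* The empty list is generalised to an accumulator [s] of the reflected nodes already passed, an
   increasing path from [1 - a]. *)
elim: l a {a0} (Nil R) al l1 => [|b l IH] a s /=.
  by move=> _ a1 as1 s1; rewrite add0r; apply: dM => //; lra.
move=> /andP[ab bl] l1 as1 s1.
rewrite [d _ _]dC -addrA addrCA.
by apply: (IH b (1 - a :: s)) => //=; rewrite as1 andbT; lra.
Qed.

(** Here [e] belongs to the curve obtained from that of [d] by replacing the part on [0, r] by a
    segment run at constant speed. The old curve is at least as long as its detour through the
    parameter [c], which is what the new one saves. *)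
Lemma length_le_surgery d e M r c :
    (forall a b, 0 <= d a b) ->
    (forall a b c, e a c <= e a b + e b c) ->
    0 < r -> r <= 1 -> 0 <= c -> c <= r ->
    (forall t t', 0 <= t -> t <= t' -> t' <= r -> e t t' <= (t' - t) / r * d 0 r) ->
    (forall t t', r <= t -> r <= t' -> e t t' = d t t') ->
  length_le d M -> length_le e (M + d 0 r - d 0 c - d c r).
Proof.
move=> d0 eT r0 r1 c0 cr er ed dM a l a0 al l1.
have after b s : r <= b -> path <=%O b s -> poly_sum e b s = poly_sum d b s.
  elim: s b => //= b' s IH b rb /andP[bb' bs].
  by rewrite IH ?ed //; lra.
(* A polygon starting before [r] costs at most its share of the segment plus an old polygon starting
   at [r]. *)
have before : a <= r -> exists s, [/\ path <=%O r s, last r s <= 1 &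
    poly_sum e a l <= (r - a) / r * d 0 r + poly_sum d r s].
  elim: l a a0 al l1 => [|b l IH] a a0 /=.
    move=> _ _ ar; exists [::]; split=> //=.
    by rewrite addr0 mulr_ge0 // divr_ge0; lra.
  move=> /andP[ab bl] l1 ar; have [br|rb] := leP b r.
    have [||s [rs s1 ls]] := IH b _ bl l1 => //; first by lra.
    exists s; split => //.
    have := er a b a0 ab br; lra.
  exists (b :: l); split => /=; rewrite ?(ltW rb) //.
  rewrite after ?(ltW rb) // -(ed r b) ?(ltW rb) //.
  have := er a r a0 ar (lexx r); have := eT a r b; lra.
have long s : path <=%O r s -> last r s <= 1 -> d 0 c + d c r + poly_sum d r s <= M.
  by move=> rs s1; rewrite -addrA; apply: (dM 0 [:: c, r & s]) => //=; rewrite c0 cr.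
have [ar|ra] := leP a r.
  have [s [rs s1 ls]] := before ar; have := long s rs s1.
  have : (r - a) / r * d 0 r <= d 0 r.
    rewrite -[leRHS]mul1r ler_wpM2r // ler_pdivrMr //; lra.
  lra.
have := long (a :: l); rewrite /= (ltW ra) => /(_ al l1).
rewrite after ?(ltW ra) //; have := d0 r a; have := d0 0 r; lra.
Qed.

End PolygonalLength.

(** * Curves on the surface of the unit cube and their symmetries *)

Section CoordinateCurves.
Set Implicit Arguments.
Unset Strict Implicit.
Context {R : realType}.
Implicit Types (x y z f : R -> R) (a b c M p q r t : R).

Definition norm3 a b c : R := Num.sqrt (a ^+ 2 + b ^+ 2 + c ^+ 2).

Lemma norm3_ge0 a b c : 0 <= norm3 a b c.
Proof. exact: sqrtr_ge0. Qed.

Lemma norm3_sq a b c : norm3 a b c ^+ 2 = a ^+ 2 + b ^+ 2 + c ^+ 2.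
Proof. by rewrite sqr_sqrtr // !addr_ge0 ?sqr_ge0. Qed.

Lemma norm3_le a b c a' b' c' :
  a ^+ 2 + b ^+ 2 + c ^+ 2 <= a' ^+ 2 + b' ^+ 2 + c' ^+ 2 ->
  norm3 a b c <= norm3 a' b' c'.
Proof. exact: ler_wsqrtr. Qed.

Lemma norm3_lt a b c a' b' c' :
  a ^+ 2 + b ^+ 2 + c ^+ 2 < a' ^+ 2 + b' ^+ 2 + c' ^+ 2 ->
  norm3 a b c < norm3 a' b' c'.
Proof.
move=> lt; rewrite ltr_sqrt //; apply: le_lt_trans lt.
by rewrite !addr_ge0 ?sqr_ge0.
Qed.

Lemma norm3Z k a b c : 0 <= k -> norm3 (k * a) (k * b) (k * c) = k * norm3 a b c.
Proof.
move=> k0; rewrite /norm3 !exprMn -!mulrDr sqrtrM ?sqr_ge0 //.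
by rewrite sqrtr_sqr ger0_norm.
Qed.

Lemma norm3D a b c a' b' c' :
  norm3 (a + a') (b + b') (c + c') <= norm3 a b c + norm3 a' b' c'.
Proof.
have n0 := norm3_ge0 a b c; have n0' := norm3_ge0 a' b' c'.
(* After squaring, what remains is the Cauchy-Schwarz inequality, proved by Lagrange's identity. *)
rewrite -ler_sqr ?nnegrE ?addr_ge0 ?norm3_ge0 // norm3_sq [leRHS]sqrrD !norm3_sq.
suff : a * a' + b * b' + c * c' <= norm3 a b c * norm3 a' b' c' by lra.
apply: le_trans (ler_norm _) _.
rewrite -ler_sqr ?nnegrE ?mulr_ge0 // exprMn !norm3_sq real_normK ?num_real //.
rewrite -subr_ge0 (_ : _ - _ = (a * b' - b * a') ^+ 2 + (a * c' - c * a') ^+ 2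
  + (b * c' - c * b') ^+ 2); last by ring.
by rewrite !addr_ge0 ?sqr_ge0.
Qed.

Definition dist3 x y z t t' := norm3 (x t - x t') (y t - y t') (z t - z t').

Definition is01 a := (a == 0) || (a == 1).

Definition unit_surface a b c :=
  [&& 0 <= a <= 1, 0 <= b <= 1, 0 <= c <= 1 & [|| is01 a, is01 b | is01 c]].

(** Continuity is asked on the whole line, which avoids subspace topologies; curves given on [0, 1]
    are extended by constants later on. *)
Definition coord_curve x y z := [/\ continuous x, continuous y, continuous z &
  forall t, 0 <= t <= 1 -> unit_surface (x t) (y t) (z t)].

Definition same_ends x x' := x 0 = x' 0 /\ x 1 = x' 1.

(** Lengths are compared through their real upper bounds, so no extended reals occur; a competitor
    of infinite length has no such bound and imposes no condition. *)
Definition coord_shortest x y z := coord_curve x y z /\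
  forall x' y' z', coord_curve x' y' z' ->
    same_ends x x' -> same_ends y y' -> same_ends z z' ->
  forall M, length_le (dist3 x' y' z') M -> length_le (dist3 x y z) M.

Definition opposite_shortest x y z := coord_shortest x y z /\
  [/\ z 0 = 0, z 1 = 1 &
      [/\ 0 < x 0 < 1, 0 < y 0 < 1, 0 < x 1 < 1 & 0 < y 1 < 1]].

Lemma dist3_ge0 x y z t t' : 0 <= dist3 x y z t t'.
Proof. exact: norm3_ge0. Qed.

Lemma dist3xx x y z t : dist3 x y z t t = 0.
Proof. by rewrite /dist3 /norm3 !subrr !expr0n !addr0 sqrtr0. Qed.

Lemma dist3C x y z t t' : dist3 x y z t t' = dist3 x y z t' t.
Proof. by congr Num.sqrt; ring. Qed.

Lemma dist3_triangle x y z t t' t'' :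
  dist3 x y z t t'' <= dist3 x y z t t' + dist3 x y z t' t''.
Proof. by apply: le_trans (norm3D _ _ _ _ _ _); apply: norm3_le; lra. Qed.

Lemma dist3_swap x y z : dist3 x y z = dist3 y x z.
Proof. by apply/funext => t; apply/funext => t'; congr Num.sqrt; ring. Qed.

Lemma dist3_flip1 x y z : dist3 (fun t => 1 - x t) y z = dist3 x y z.
Proof. by apply/funext => t; apply/funext => t'; congr Num.sqrt; ring. Qed.

Lemma dist3_flip3 x y z : dist3 x y (fun t => 1 - z t) = dist3 x y z.
Proof. by apply/funext => t; apply/funext => t'; congr Num.sqrt; ring. Qed.

Lemma continuous_flip x : continuous x -> continuous (fun t => 1 - x t).
Proof. by move=> cx t; apply: cvgB; [exact: cvg_cst|exact: cx]. Qed.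

Lemma continuous_rev x : continuous x -> continuous (fun t => x (1 - t)).
Proof.
move=> cx t; apply: (@continuous_comp _ _ _ (fun t => 1 - t) x); last exact: cx.
by apply: cvgB; [exact: cvg_cst|exact: cvg_id].
Qed.

Lemma is01_flip a : is01 (1 - a) = is01 a.
Proof.
apply/idP/idP => /orP[]/eqP ha; apply/orP; [right|left|right|left]; apply/eqP; lra.
Qed.

Lemma unit_surface_swap a b c : unit_surface a b c -> unit_surface b a c.
Proof. by case/and4P=> a01 b01 c01 s; rewrite /unit_surface a01 b01 c01 orbCA. Qed.

Lemma unit_surface_flip1 a b c : unit_surface a b c -> unit_surface (1 - a) b c.
Proof.
case/and4P=> a01 b01 c01 s.
by rewrite /unit_surface is01_flip b01 c01 s !andbT; lra.
Qed.

Lemma unit_surface_flip3 a b c : unit_surface a b c -> unit_surface a b (1 - c).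
Proof.
case/and4P=> a01 b01 c01 s.
by rewrite /unit_surface is01_flip b01 a01 s !andbT; lra.
Qed.

Lemma coord_curve_swap x y z : coord_curve x y z -> coord_curve y x z.
Proof. by case=> cx cy cz xyz; split => // t /xyz/unit_surface_swap. Qed.

Lemma coord_curve_flip1 x y z :
  coord_curve x y z -> coord_curve (fun t => 1 - x t) y z.
Proof.
case=> cx cy cz xyz; split => //; first exact: continuous_flip.
by move=> t /xyz/unit_surface_flip1.
Qed.

Lemma coord_curve_flip3 x y z :
  coord_curve x y z -> coord_curve x y (fun t => 1 - z t).
Proof.
case=> cx cy cz xyz; split => //; first exact: continuous_flip.
by move=> t /xyz/unit_surface_flip3.
Qed.

Lemma coord_curve_rev x y z : coord_curve x y z ->
  coord_curve (fun t => x (1 - t)) (fun t => y (1 - t)) (fun t => z (1 - t)).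
Proof.
case=> cx cy cz xyz; split; try exact: continuous_rev.
by move=> t t01; apply: xyz; lra.
Qed.

Lemma coord_shortest_flip3 x y z :
  coord_shortest x y z -> coord_shortest x y (fun t => 1 - z t).
Proof.
case=> xyz sh; split; first exact: coord_curve_flip3.
move=> x' y' z' /coord_curve_flip3 c' ex ey [ez0 ez1] M; rewrite dist3_flip3.
rewrite -(dist3_flip3 x' y' z'); apply: sh => //; split; lra.
Qed.

Lemma opposite_shortest_swap x y z :
  opposite_shortest x y z -> opposite_shortest y x z.
Proof.
case=> -[xyz sh] [z0 z1 [hx0 hy0 hx1 hy1]]; split => //.
split; first exact: coord_curve_swap.
move=> x' y' z' /coord_curve_swap c' ex ey ez M; rewrite dist3_swap.
by rewrite (dist3_swap y x z); exact: sh.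
Qed.

Lemma opposite_shortest_flip1 x y z :
  opposite_shortest x y z -> opposite_shortest (fun t => 1 - x t) y z.
Proof.
case=> -[xyz sh] [z0 z1 [hx0 hy0 hx1 hy1]]; split; last by do !split => //; lra.
split; first exact: coord_curve_flip1.
move=> x' y' z' /coord_curve_flip1 c' [ex0 ex1] ey ez M; rewrite dist3_flip1.
by rewrite -(dist3_flip1 x' y' z'); apply: sh => //; split; lra.
Qed.

Lemma opposite_shortest_flip2 x y z :
  opposite_shortest x y z -> opposite_shortest x (fun t => 1 - y t) z.
Proof.
by move=> /opposite_shortest_swap/opposite_shortest_flip1/opposite_shortest_swap.
Qed.

Lemma coord_shortest_rev x y z : coord_shortest x y z ->
  coord_shortest (fun t => x (1 - t)) (fun t => y (1 - t)) (fun t => z (1 - t)).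
Proof.
case=> xyz sh; split; first exact: coord_curve_rev.
move=> x' y' z' /coord_curve_rev c' [ex0 ex1] [ey0 ey1] [ez0 ez1] M.
rewrite !subr0 !subrr in ex0 ex1 ey0 ey1 ez0 ez1.
move=> lM; apply: (@length_le_rev _ (dist3 x y z)); first exact: dist3C.
by apply: (sh _ _ _ c'); rewrite /same_ends ?subr0 ?subrr //;
  apply: (@length_le_rev _ (dist3 x' y' z')) => //; exact: dist3C.
Qed.

(** Reversing time exchanges bottom and top, and the reflection in z restores them; statements about
    the bottom face thus carry over to the top face. *)
Lemma opposite_shortest_rev x y z : opposite_shortest x y z ->
  opposite_shortest (fun t => x (1 - t)) (fun t => y (1 - t))
    (fun t => 1 - z (1 - t)).
Proof.
case=> /coord_shortest_rev/coord_shortest_flip3 sh [z0 z1 [hx0 hy0 hx1 hy1]].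
by split=> //; rewrite !subr0 !subrr z0 z1 subr0 subrr.
Qed.

End CoordinateCurves.

(** * Hitting times and intermediate values of continuous functions *)

Section Crossings.
Set Implicit Arguments.
Unset Strict Implicit.
Context {R : realType}.
Implicit Types (f : R -> R) (a b p q t v : R).

(** The times in [a, b] at which [f] equals [v] form a nonempty compact set, which has a least
    element. *)
Lemma first_hit f a b v : continuous f -> a <= b -> f b = v ->
  exists q, [/\ a <= q, q <= b, f q = v & forall t, a <= t -> t < q -> f t != v].
Proof.
move=> cf ab fb; pose E := `[a, b]%classic `&` (f @^-1` [set v]).
have cE : compact E.
  apply: compact_closedI; first exact: segment_compact.
  by apply: preimage_closed; [move=> t _; exact: cf|exact: closed_eq].
have E0 : E !=set0 by exists b; split; rewrite /= ?in_itv /= ?ab /=.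
have [|q] := @compact_EVT_min _ _ id _ E0 cE.
  by apply: continuous_subspaceT => t; exact: cvg_id.
rewrite inE => -[/= qab fq] qmin; move: qab; rewrite in_itv /= => /andP[aq qb].
exists q; split=> // t at_ tq; apply/eqP => ftv.
suff : q <= t by lra.
by apply: qmin; rewrite inE; split; rewrite //= in_itv /= at_ /=; lra.
Qed.

Lemma last_hit f a b v : continuous f -> a <= b -> f a = v ->
  exists p, [/\ a <= p, p <= b, f p = v & forall t, p < t -> t <= b -> f t != v].
Proof.
move=> cf ab fa.
have cg : continuous (fun t => f (- t)).
  by move=> t; apply: continuous_comp; [exact: opp_continuous|exact: cf].
have [|| q [bq qa fq qmin]] := @first_hit _ (- b) (- a) v cg.
- by rewrite lerN2.
- by rewrite opprK.
exists (- q); split=> // [||t pt tb]; [lra|lra|].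
by rewrite -(opprK t); apply: qmin; lra.
Qed.

(** Take for [q] the first time after [a] with value 1, then for [p] the last time before [q] with
    value 0. *)
Lemma crossing f a b : continuous f -> a <= b -> f a = 0 -> f b = 1 ->
  exists p q, [/\ a <= p, p < q & q <= b] /\ [/\ f p = 0, f q = 1 &
    forall t, p < t -> t < q -> f t != 0 /\ f t != 1].
Proof.
move=> cf ab fa fb.
have [q [aq qb fq qmin]] := first_hit cf ab fb.
have [p [ap pq fp pmax]] := last_hit cf aq fa.
exists p, q; split; split=> //.
  by rewrite lt_neqAle pq andbT; apply/eqP => pqE; move: fq; rewrite -pqE fp; lra.
by move=> t pt tq; split; [apply: pmax|apply: qmin] => //; lra.
Qed.

Lemma intermediate_value f p q v : continuous f -> p <= q ->
  f p < v < f q \/ f q < v < f p -> exists t, [/\ p < t, t < q & f t = v].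
Proof.
move=> cf pq h.
have [||t] := @IVT _ f p q v pq; first exact: continuous_subspaceT.
  by rewrite ge_min le_max; case: h => /andP[h1 h2]; rewrite !(ltW h1, ltW h2) ?orbT.
rewrite in_itv /= => /andP[pt tq] ft; exists t; split => //.
  by rewrite lt_neqAle pt andbT; apply/eqP => e; move: h; rewrite e ft; lra.
by rewrite lt_neqAle tq andbT; apply/eqP => e; move: h; rewrite -e ft; lra.
Qed.

Lemma is01_constant f p q : continuous f -> p < q ->
  (forall t, p < t -> t < q -> is01 (f t)) -> is01 (f p) /\ f q = f p.
Proof.
move=> cf pq f01; pose m := (p + q) / 2.
have fm : is01 (f m) by apply: f01; rewrite /m; lra.
(* Of three distinct points between [a] and [b], at least one is neither 0 nor 1. *)
have between a b : a != b -> exists2 v, ~~ is01 v & a < v < b \/ b < v < a.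
  move=> ab.
  have bt k : 0 < k < 1 -> a < a + k * (b - a) < b \/ b < a + k * (b - a) < a.
    move=> k01; case: (ltgtP a b) ab => // ab _; [left|right]; nra.
  case h1 : (is01 (a + 1 / 4 * (b - a))); last first.
    by eexists; [exact: negbT h1|apply: bt; lra].
  case h2 : (is01 (a + 1 / 2 * (b - a))); last first.
    by eexists; [exact: negbT h2|apply: bt; lra].
  exists (a + 3 / 4 * (b - a)); last by apply: bt; lra.
  by move: h1 h2 ab; rewrite /is01 => /orP[]/eqP h1 /orP[]/eqP h2 /eqP ab;
    apply/norP; split; apply/eqP; lra.
(* Otherwise [f] would take such an intermediate value strictly between [p] and [m]. *)
have pE : f p = f m.
  apply/eqP/negPn/negP => /between[v v01 /(intermediate_value cf)].
  move=> [|t [pt tm ft]]; first by rewrite /m; lra.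
  by move: v01; rewrite -ft f01 //; rewrite /m in tm; lra.
have qE : f q = f m.
  apply/eqP/negPn/negP; rewrite eq_sym => /between[v v01 /(intermediate_value cf)].
  move=> [|t [pt tm ft]]; first by rewrite /m; lra.
  by move: v01; rewrite -ft f01 //; rewrite /m in pt; lra.
by rewrite pE qE.
Qed.
End Crossings.

(** * Shortest curves from the bottom to the top of the unit cube *)

Section ShortestCurves.
Set Implicit Arguments.
Unset Strict Implicit.
Context {R : realType}.
Implicit Types (x y z : R -> R) (a b c M p q r t : R).

Lemma continuous_affine a b : continuous (fun t : R => a + t * b).
Proof. by move=> t; apply: cvgD; [exact: cvg_cst|apply: cvgM; [exact: cvg_id|exact: cvg_cst]]. Qed.

Lemma continuous_maxr (f : R -> R) a :
  continuous f -> continuous (fun t => Num.max (f t) a).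
Proof. by move=> cf t; apply: continuous_max; [exact: cf|exact: cvg_cst]. Qed.

Lemma continuous_minr (f : R -> R) a :
  continuous f -> continuous (fun t => Num.min (f t) a).
Proof. by move=> cf t; apply: continuous_min; [exact: cf|exact: cvg_cst]. Qed.

(* The competitor is the segment joining the endpoints in the plane obtained by
   unfolding the faces z = 0, y = 0 and z = 1; the second plane coordinate v is y
   on the first face, - z on the second and - 1 - y on the third. *)
Lemma shortest_le_unfolding x y z : opposite_shortest x y z ->
  length_le (dist3 x y z) (norm3 (x 0 - x 1) (1 + y 0 + y 1) 0).
Proof.
case=> -[_ sh] [z0 z1 [hx0 hy0 hx1 hy1]].
pose u t := x 0 + t * (x 1 - x 0); pose v t := y 0 + t * (- 1 - y 1 - y 0).
(* Folding back: [Y] is the distance from [v] to [-1, 0], and [Z] is [- v] truncated to [0, 1]. *)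
pose Y t := Num.max (v t) 0 + Num.max (- 1 - v t) 0.
pose Z t := Num.min (Num.max (- v t) 0) 1.
have cu : continuous u by exact: continuous_affine.
have cv : continuous v by exact: continuous_affine.
have fold t : [\/ [/\ 0 <= v t, Y t = v t & Z t = 0],
    [/\ -1 <= v t <= 0, Y t = 0 & Z t = - v t] |
    [/\ v t <= -1, Y t = -1 - v t & Z t = 1]].
  rewrite /Y /Z; have /orP[h1|h1] := le_total 0 (v t).
    by apply: Or31; rewrite max_l // !max_r ?min_l ?addr0 //; try split; lra.
  rewrite (@max_r _ _ (v t)) // (@max_l _ _ (- v t)); last by lra.
  have /orP[h2|h2] := le_total (-1) (v t).
    by apply: Or32; rewrite max_r ?min_l ?addr0 //; try split; lra.
  by apply: Or33; rewrite max_l ?min_r ?add0r //; try split; lra.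
apply: (sh u Y Z).
- split => //.
  + move=> t; apply: cvgD; first exact: (@continuous_maxr v 0 cv).
    apply: (@continuous_maxr (fun t => - 1 - v t)) => s.
    by apply: cvgB; [exact: cvg_cst|exact: cv].
  + apply: (@continuous_minr (fun t => Num.max (- v t) 0)).
    by apply: (@continuous_maxr (fun t => - v t)) => s; apply: cvgN; exact: cv.
  move=> t t01.
  have u01 : 0 <= u t <= 1 by rewrite /u; nra.
  have v12 : -2 <= v t <= 1 by rewrite /v; nra.
  rewrite /unit_surface u01 /= /is01.
  by case: (fold t) => -[vt -> ->]; rewrite ?eqxx ?orbT andbT; lra.
- by rewrite /same_ends /u; split; ring.
- by rewrite /same_ends; case: (fold 0) => -[vt -> _]; case: (fold 1) => -[vt' -> _];
    move: vt vt'; rewrite /v; lra.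
- by rewrite /same_ends; case: (fold 0) => -[vt _ ->]; case: (fold 1) => -[vt' _ ->];
    move: vt vt'; rewrite /v; lra.
apply: length_le_lipschitz; first exact: norm3_ge0.
move=> t t' t0 tt' t1; rewrite -norm3Z; last by lra.
apply: norm3_le; rewrite mulr0.
have -> : u t - u t' = (t' - t) * (x 0 - x 1) by rewrite /u; ring.
have -> : (t' - t) * (1 + y 0 + y 1) = v t - v t' by rewrite /v; ring.
have vtt' : v t' <= v t by rewrite /v; nra.
(* Folding the plane onto the cube does not increase distances. *)
suff : (Y t - Y t') ^+ 2 + (Z t - Z t') ^+ 2 <= (v t - v t') ^+ 2 by lra.
by case: (fold t) => -[vt -> ->]; case: (fold t') => -[vt' -> ->]; nra.
Qed.

(** The unfolding bound for the polygon with nodes 0, p, q, 1; the two exclusions below contradict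
    it. *)
Lemma norm3_lower x y z p q : opposite_shortest x y z -> 0 <= p -> p <= q -> q <= 1 ->
  dist3 x y z 0 p + dist3 x y z p q + dist3 x y z q 1 <=
    norm3 (x 0 - x 1) (1 + y 0 + y 1) 0.
Proof.
move=> sh p0 pq q1; have := shortest_le_unfolding sh => /(_ 0 [:: p; q; 1]).
by rewrite /= p0 pq q1 lexx addr0 addrA; exact.
Qed.

Lemma lateral_edges_excluded x y z p q : opposite_shortest x y z ->
  0 <= p -> p <= q -> q <= 1 -> x p = 0 -> y p = 0 -> x q = 1 -> y q = 0 -> False.
Proof.
move=> sh p0 pq q1 xp yp xq yq; have := norm3_lower sh p0 pq q1.
case: sh => _ [z0 z1 [hx0 hy0 hx1 hy1]]; apply/negP; rewrite -ltNge.
rewrite /dist3 xp yp xq yq z0 z1.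
(* The x-components of the outer pieces are dropped and that of the middle piece is turned into the
   y-direction. The three vectors then add up to (0, 1 + y 0 + y 1, -1), while [x 0 - x 1] is less
   than 1 in absolute value. *)
have h1 : norm3 0 (y 0) (0 - z p) <= norm3 (x 0 - 0) (y 0 - 0) (0 - z p).
  by apply: norm3_le; nra.
have h2 : norm3 0 (y 1) (z q - 1) <= norm3 (1 - x 1) (0 - y 1) (z q - 1).
  by apply: norm3_le; nra.
have h3 : norm3 0 1 (z p - z q) <= norm3 (0 - 1) (0 - 0) (z p - z q).
  by apply: norm3_le; nra.
have := norm3D 0 (y 0) (0 - z p) 0 1 (z p - z q).
have := norm3D (0 + 0) (y 0 + 1) (0 - z p + (z p - z q)) 0 (y 1) (z q - 1).
have : norm3 (x 0 - x 1) (1 + y 0 + y 1) 0 <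
    norm3 (0 + 0 + 0) (y 0 + 1 + y 1) (0 - z p + (z p - z q) + (z q - 1)).
  by apply: norm3_lt; nra.
lra.
Qed.

Lemma vertical_edge_excluded x y z p q : opposite_shortest x y z ->
  0 <= p -> p <= q -> q <= 1 -> x p = 0 -> y p = 0 -> z p = 0 ->
  x q = 0 -> y q = 0 -> z q = 1 -> False.
Proof.
move=> sh p0 pq q1 xp yp zp xq yq zq; have := norm3_lower sh p0 pq q1.
case: sh => _ [z0 z1 [hx0 hy0 hx1 hy1]]; apply/negP; rewrite -ltNge.
rewrite /dist3 xp yp xq yq z0 z1 zp zq.
(* With the vertical edge turned into the y-direction and signs adjusted, the pieces add up to (x 0
   + x 1, 1 + y 0 + y 1, 0), and [x 0 + x 1] exceeds the absolute value of [x 0 - x 1]. *)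
have h1 : norm3 (x 0) (y 0) 0 <= norm3 (x 0 - 0) (y 0 - 0) (0 - 0).
  by apply: norm3_le; nra.
have h2 : norm3 (x 1) (y 1) 0 <= norm3 (0 - x 1) (0 - y 1) (1 - 1).
  by apply: norm3_le; nra.
have h3 : norm3 0 1 0 <= norm3 (0 - 0) (0 - 0) (0 - 1 : R).
  by apply: norm3_le; nra.
have := norm3D (x 0) (y 0) 0 0 1 0.
have := norm3D (x 0 + 0) (y 0 + 1) (0 + 0) (x 1) (y 1) 0.
have : norm3 (x 0 - x 1) (1 + y 0 + y 1) 0 <
    norm3 (x 0 + 0 + x 1) (y 0 + 1 + y 1) (0 + 0 + 0).
  by apply: norm3_lt; nra.
lra.
Qed.

(* Otherwise replace the curve on [0, r] by the segment in the face z = 0. *)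
Lemma bottom_initial x y z r t : opposite_shortest x y z ->
  0 <= t -> t <= r -> r <= 1 -> z r = 0 -> z t = 0.
Proof.
move=> sh t0 tr r1 zr; have := shortest_le_unfolding sh; set L := norm3 _ _ _ => lL.
case: (sh) => -[[cx cy cz xyz] minxyz] [z0 z1 [hx0 hy0 hx1 hy1]].
have [r0|r0] := leP r 0; first by rewrite (_ : t = 0) //; lra.
apply/eqP/negPn/negP => zt.
(* Affine from [f 0] to [f r] up to time [r] and equal to [f] afterwards; a single formula with max
   and min makes continuity immediate. *)
pose cut f s := f (Num.max s r) - f r + f 0 + Num.min s r * ((f r - f 0) / r).
have cut_le f s : s <= r -> cut f s = f 0 + s * ((f r - f 0) / r).
  by move=> sr; rewrite /cut max_r // min_l // subrr add0r.
have cut_ge f s : r <= s -> cut f s = f s.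
  by move=> sr; rewrite /cut max_l // min_r //; field; lra.
have ends f : same_ends f (cut f).
  by split; [rewrite cut_le ?(ltW r0) // mul0r addr0|rewrite cut_ge].
have ccut f : continuous f -> continuous (cut f).
  move=> cf s; apply: cvgD.
    apply: cvgD; last exact: cvg_cst.
    apply: cvgB; last exact: cvg_cst.
    apply: (@continuous_comp _ _ _ (fun s => Num.max s r) f); last exact: cf.
    by apply: continuous_maxr => q; exact: cvg_id.
  apply: cvgM; last exact: cvg_cst.
  by apply: continuous_minr => q; exact: cvg_id.
pose D := dist3 x y z 0 t + dist3 x y z t r - dist3 x y z 0 r.
have D0 : 0 < D.
  have /xyz/and4P[_ _ zt01 _] : 0 <= t <= 1 by lra.
  have zt0 : 0 < z t by rewrite lt_neqAle eq_sym zt; case/andP: zt01.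
  (* The piece from [t] to [r] is reflected in the horizontal plane at height [z t]. Its length is
     unchanged, but the vertical components now add up instead of cancelling. *)
  have := norm3D (x 0 - x t) (y 0 - y t) (z 0 - z t) (x t - x r) (y t - y r) (z 0 - z t).
  have : norm3 (x t - x r) (y t - y r) (z 0 - z t) <= dist3 x y z t r.
    by apply: norm3_le; rewrite z0 zr; nra.
  have : dist3 x y z 0 r < norm3 (x 0 - x t + (x t - x r)) (y 0 - y t + (y t - y r))
      (z 0 - z t + (z 0 - z t)).
    by apply: norm3_lt; rewrite z0 zr; nra.
  rewrite /D [dist3 _ _ _ 0 t]/dist3; lra.
have shorten M : length_le (dist3 x y z) M -> length_le (dist3 x y z) (M - D).
  move=> lM; apply: (minxyz (cut x) (cut y) (cut z)).
  - split; try exact: ccut.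
    move=> s s01; have [rs|/ltW sr] := leP r s; first by rewrite !cut_ge ?xyz.
    have k01 : 0 <= s / r <= 1.
      by apply/andP; split; [apply: divr_ge0|rewrite ler_pdivrMr]; lra.
    have cutE f : cut f s = f 0 + s / r * (f r - f 0) by rewrite cut_le //; ring.
    have /xyz/and4P[x001 y001 _ _] : 0 <= (0 : R) <= 1 by rewrite lexx ler01.
    have /xyz/and4P[xr01 yr01 _ _] : 0 <= r <= 1 by lra.
    have cut01 f : 0 <= f 0 <= 1 -> 0 <= f r <= 1 -> 0 <= cut f s <= 1.
      by rewrite cutE => f0 fr; nra.
    have cutz : cut z s = 0 by rewrite cutE z0 zr subrr mulr0 addr0.
    by rewrite /unit_surface !cut01 ?z0 ?zr ?lexx ?ler01 // cutz /is01 eqxx /= !orbT.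
  - exact: ends.
  - exact: ends.
  - exact: ends.
  rewrite (_ : M - D = M + dist3 x y z 0 r - dist3 x y z 0 t - dist3 x y z t r);
    last by rewrite /D; ring.
  apply: length_le_surgery lM => //.
  - exact: dist3_ge0.
  - exact: dist3_triangle.
  - move=> s s' s0 ss' s'r; rewrite /dist3 -norm3Z; last by rewrite divr_ge0; lra.
    have E f : cut f s - cut f s' = (s' - s) / r * (f 0 - f r).
      by rewrite !cut_le //; [ring|lra].
    by rewrite -!E.
  - by move=> s s' rs rs'; rewrite /dist3 !cut_ge.
(* By minimality each upper bound can be lowered by [D]. Iterating makes it negative, which the
   polygon with a single node refutes. *)
have short n : length_le (dist3 x y z) (L - n%:R * D).
  elim: n => [|n IH]; first by rewrite mul0r subr0.
  rewrite (_ : _ - _ = L - n%:R * D - D); last by rewrite -natr1; ring.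
  exact: shorten.
have := short (Num.bound (L / D)) 0 [::]; rewrite /= lexx ler01 => /(_ isT isT isT).
have := @archi_boundP _ (L / D); rewrite divr_ge0 ?norm3_ge0 ?(ltW D0) //.
by move=> /(_ isT); rewrite ltr_pdivrMr //; lra.
Qed.

Lemma top_final x y z r t : opposite_shortest x y z ->
  0 <= r -> r <= t -> t <= 1 -> z r = 1 -> z t = 1.
Proof.
move=> /opposite_shortest_rev sh r0 rt t1 zr.
suff : 1 - z (1 - (1 - t)) = 0 by rewrite subKr; lra.
apply: (bottom_initial (r := 1 - r) sh); rewrite ?subKr ?zr; lra.
Qed.

(** Traversal of the face x = b; exchanging the first two arguments gives y = b. *)
Definition meets_lateral x y z b := exists t,
  [/\ 0 <= t <= 1, x t = b, 0 < y t < 1 & 0 < z t < 1].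

Lemma not_opposite_laterals_ordered x y z p q : opposite_shortest x y z ->
  0 <= p -> p <= q -> q <= 1 -> x p = 0 -> 0 < z p -> x q = 1 -> z q < 1 -> False.
Proof.
move=> sh p0 pq q1 xp zp xq zq.
case: (sh) => -[[cx cy cz xyz] _] _.
have [p' [q' [[pp' pq' qq'] [xp' xq' xpq]]]] := crossing cx pq xp xq.
(* Height 0 after [p] would force [z p = 0], and height 1 before [q] would force [z q = 1]. *)
have z01 t : p <= t -> t <= q -> 0 < z t < 1.
  move=> pt tq; have /xyz/and4P[_ _ /andP[zt0 zt1] _] : 0 <= t <= 1 by lra.
  rewrite !lt_neqAle zt0 zt1 !andbT; apply/andP; split; apply/eqP => zt.
    have := @bottom_initial _ _ _ t p sh; lra.
  have := @top_final _ _ _ t q sh; lra.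
(* Neither x nor z is 0 or 1 between [p'] and [q'], so y is, and by continuity y is constant. *)
have [|yp' yq'] := is01_constant cy pq'.
  move=> t p't tq'; have /xyz/and4P[_ _ _ /or3P[|//|]] : 0 <= t <= 1 by lra.
    by have [xt0 xt1] := xpq t p't tq'; rewrite /is01 (negPf xt0) (negPf xt1).
  by have := z01 t; rewrite /is01 => zt /orP[]/eqP; lra.
case/orP: yp' => /eqP yp'; rewrite yp' in yq'.
  by apply: (lateral_edges_excluded (p := p') (q := q') sh) => //; lra.
apply: (lateral_edges_excluded (p := p') (q := q') (opposite_shortest_flip2 sh)) => //;
  lra.
Qed.

Lemma not_opposite_laterals x y z : opposite_shortest x y z ->
  meets_lateral x y z 0 -> meets_lateral x y z 1 -> False.
Proof.
move=> sh [p [p01 xp yp zp]] [q [q01 xq yq zq]]; have [pq|qp] := leP p q.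
  by apply: (not_opposite_laterals_ordered (p := p) (q := q) sh) => //; lra.
apply: (not_opposite_laterals_ordered (p := q) (q := p)
  (opposite_shortest_flip1 sh)) => //; lra.
Qed.

Lemma some_lateral x y z : opposite_shortest x y z ->
  [\/ meets_lateral x y z 0, meets_lateral x y z 1,
      meets_lateral y x z 0 | meets_lateral y x z 1].
Proof.
move=> sh; apply: contrapT => none.
have nx0 : ~ meets_lateral x y z 0 by move=> m; apply: none; exact: Or41.
have nx1 : ~ meets_lateral x y z 1 by move=> m; apply: none; exact: Or42.
have ny0 : ~ meets_lateral y x z 0 by move=> m; apply: none; exact: Or43.
have ny1 : ~ meets_lateral y x z 1 by move=> m; apply: none; exact: Or44.
case: (sh) => -[[cx cy cz xyz] _] [z0 z1 _].
have [p [q [[p0 pq q1] [zp zq zpq]]]] := crossing cz ler01 z0 z1.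
(* A point at height strictly between 0 and 1 that is interior to no lateral face lies on a vertical
   edge. *)
have xy01 t : p < t -> t < q -> is01 (x t) /\ is01 (y t).
  move=> pt tq; have t01 : 0 <= t <= 1 by lra.
  have /xyz/and4P[/andP[x0 x1] /andP[y0 y1] /andP[z0' z1'] s] := t01.
  have [zt0 zt1] := zpq t pt tq.
  have zt : 0 < z t < 1 by rewrite !lt_neqAle z0' z1' zt1 eq_sym zt0.
  have yx : is01 (x t) -> is01 (y t).
    move=> xt; apply/negPn/negP => /norP[yt0 yt1].
    have yt : 0 < y t < 1 by rewrite !lt_neqAle y0 y1 yt1 eq_sym yt0.
    by case/orP: xt => /eqP xt; [apply: nx0|apply: nx1]; exists t.
  have xy : is01 (y t) -> is01 (x t).
    move=> yt; apply/negPn/negP => /norP[xt0 xt1].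
    have xt : 0 < x t < 1 by rewrite !lt_neqAle x0 x1 xt1 eq_sym xt0.
    by case/orP: yt => /eqP yt; [apply: ny0|apply: ny1]; exists t.
  case/or3P: s => [xt|yt|]; [by split; auto|by split; auto|].
  by rewrite /is01 (negPf zt0) (negPf zt1).
have [|xp xq] := is01_constant cx pq; first by move=> t pt /(xy01 t pt)[].
have [|yp yq] := is01_constant cy pq; first by move=> t pt /(xy01 t pt)[].
case/orP: xp => /eqP xp; rewrite xp in xq; case/orP: yp => /eqP yp; rewrite yp in yq.
- by apply: (vertical_edge_excluded sh p0 (ltW pq) q1).
- apply: (vertical_edge_excluded (opposite_shortest_flip2 sh) p0 (ltW pq) q1); lra.
- apply: (vertical_edge_excluded (opposite_shortest_flip1 sh) p0 (ltW pq) q1); lra.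
apply: (vertical_edge_excluded
  (opposite_shortest_flip2 (opposite_shortest_flip1 sh)) p0 (ltW pq) q1); lra.
Qed.

End ShortestCurves.

(** * Coordinates on an arbitrary cube *)

Section CubeChart.
Set Implicit Arguments.
Unset Strict Implicit.
Context {R : realType}.
Variable Q : cube R.
Implicit Types (u v : 'rV[R]_3) (g : R -> 'rV[R]_3).

Definition cube_coord v : 'rV[R]_3 :=
  (cube_side Q)^-1 *: ((v - cube_vertex Q) *m (cube_frame Q)^T).

Lemma cube_chartK : cancel (cube_chart Q) cube_coord.
Proof.
move=> u; rewrite /cube_coord /cube_chart addrC addKr -scalemxAl.
rewrite -mulmxA cube_frame_orthonormal mulmx1 scalerA mulVf ?scale1r //.
by rewrite gt_eqF // cube_side_gt0.
Qed.

Lemma cube_coordK : cancel cube_coord (cube_chart Q).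
Proof.
move=> v; rewrite /cube_coord /cube_chart -scalemxAl scalerA divff; last first.
  by rewrite gt_eqF // cube_side_gt0.
by rewrite scale1r -mulmxA (mulmx1C (cube_frame_orthonormal Q)) mulmx1 addrC subrK.
Qed.

Lemma edistE n (u v : 'rV[R]_n) :
  Defs.edist u v = Num.sqrt (((u - v) *m (u - v)^T) 0 0).
Proof.
by rewrite mxE; congr Num.sqrt; apply: eq_bigr => j _; rewrite !mxE expr2.
Qed.

(** With the squared distance written as a product of a row and its transpose, the frame meets its
    own transpose and cancels. *)
Lemma edist_chart u v :
  Defs.edist (cube_chart Q u) (cube_chart Q v) = cube_side Q * Defs.edist u v.
Proof.
have -> : Defs.edist (cube_chart Q u) (cube_chart Q v) =
    Num.sqrt (cube_side Q ^+ 2 * (((u - v) *m (u - v)^T) 0 0)).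
  rewrite edistE /cube_chart opprD addrACA subrr add0r -scalerBr -mulmxBl.
  rewrite linearZ /= -scalemxAl -scalemxAr scalerA mxE trmx_mul mulmxA.
  by rewrite -(mulmxA (u - v)) cube_frame_orthonormal mulmx1 expr2.
rewrite sqrtrM ?sqr_ge0 // sqrtr_sqr ger0_norm ?ltW ?cube_side_gt0 //.
by rewrite -edistE.
Qed.

Lemma continuous_cube_coord j : continuous (fun v => cube_coord v 0 j).
Proof.
have -> : (fun v => cube_coord v 0 j) = (fun v => (cube_side Q)^-1 *
    \sum_k (v 0 k - cube_vertex Q 0 k) * (cube_frame Q)^T k j).
  by apply/funext => v; rewrite !mxE; congr (_ * _); apply: eq_bigr => k _; rewrite !mxE.
pose F (w : 'rV[R]_3) := \sum_k (w 0 k - cube_vertex Q 0 k) * (cube_frame Q)^T k j.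
have cs : continuous F.
  apply: continuous_big; first exact: add_continuous.
  move=> k _ w.
  apply: (@continuous_comp _ _ _ (fun w : 'rV[R]_3 => w 0 k)
    (fun a => (a - cube_vertex Q 0 k) * (cube_frame Q)^T k j)).
    exact: coord_continuous.
  apply: cvgM; last exact: cvg_cst.
  by apply: cvgB; [exact: cvg_id|exact: cvg_cst].
move=> v; apply: (@continuous_comp _ _ _ F (fun a => (cube_side Q)^-1 * a)).
  exact: cs.
by apply: cvgM; [exact: cvg_cst|exact: cvg_id].
Qed.

Lemma continuous_cube_chart (h : R -> 'rV[R]_3) :
  (forall j, continuous (fun t => h t 0 j)) -> continuous (cube_chart Q \o h).
Proof.
move=> ch.
suff cs : continuous (fun t => h t *m cube_frame Q).
  by move=> t; apply: cvgD; [exact: cvg_cst|apply: cvgZ; [exact: cvg_cst|exact: cs]].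
have -> : (fun t => h t *m cube_frame Q) =
    (fun t => \sum_j h t 0 j *: row j (cube_frame Q)).
  by apply/funext => s; exact: mulmx_sum_row.
apply: continuous_big; first exact: add_continuous.
by move=> j _ s; apply: cvgZ; [exact: ch|exact: cvg_cst].
Qed.

Lemma solid_cubeP v : solid_cube Q v <-> forall j, 0 <= cube_coord v 0 j <= 1.
Proof.
split=> [[u u01 <-] j|v01]; first by rewrite cube_chartK.
by exists (cube_coord v); rewrite ?cube_coordK.
Qed.

Lemma closed_solid_cube : closed (solid_cube Q).
Proof.
have -> : solid_cube Q = \bigcap_(j in [set: 'I_3])
    ((fun v => cube_coord v 0 j) @^-1` `[0, 1]%classic).
  apply/seteqP; split=> v; first by move/solid_cubeP => v01 j _; rewrite /= in_itv /=.
  by move=> v01; apply/solid_cubeP => j; have := v01 j I; rewrite /= in_itv.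
apply: closed_bigI => j _; apply: preimage_closed; last exact: itv_closed.
by move=> v _; exact: continuous_cube_coord.
Qed.

Lemma cube_surfaceP v : cube_surface Q v <->
  (forall j, 0 <= cube_coord v 0 j <= 1) /\ exists j, is01 (cube_coord v 0 j).
Proof.
rewrite /cube_surface -(closure_id _).1; last exact: closed_solid_cube.
split=> -[].
  move=> /solid_cubeP v01 vint; split=> //; apply: contrapT => none; apply: vint.
  have vin j : 0 < cube_coord v 0 j < 1.
    have : ~~ is01 (cube_coord v 0 j) by apply/negP => vj; apply: none; exists j.
    case/norP => v0 v1; have /andP[vj0 vj1] := v01 j.
    by rewrite !lt_neqAle vj0 vj1 v1 eq_sym v0.
  (* Finitely many strict inequalities between continuous functions persist near [v]. *)
  have : \forall w \near v, forall j, 0 < cube_coord w 0 j < 1.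
    apply: (@filter_forall _ _ (fun j w => 0 < cube_coord w 0 j < 1) _ (nbhs_filter v)) => j.
    have /andP[vj0 vj1] := vin j.
    have cj : cube_coord w 0 j @[w --> v] --> cube_coord v 0 j.
      exact: continuous_cube_coord.
    near=> w; apply/andP; split; near: w; [exact: cvgr_gt cj _ _|exact: cvgr_lt cj _ _].
  apply: filterS => w w01; apply/solid_cubeP => j.
  by have /andP[w0 w1] := w01 j; rewrite !ltW.
move=> v01 [j vj]; split; first exact/solid_cubeP.
move=> vint.
(* The line through [v] in the j-th direction leaves the cube at once on one side, so [v] is not
   interior. *)
pose h s := cube_coord v + s *: delta_mx 0 j.
have ch : continuous (cube_chart Q \o h).
  apply: continuous_cube_chart => k.
  have -> : (fun s => h s 0 k) =
      (fun s => cube_coord v 0 k + s * (delta_mx 0 j : 'rV[R]_3) 0 k).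
    by apply/funext => s; rewrite !mxE.
  exact: continuous_affine.
have h0 : (cube_chart Q \o h) 0 = v by rewrite /= /h scale0r addr0 cube_coordK.
have hj s : h s 0 j = cube_coord v 0 j + s by rewrite !mxE !eqxx mulr1.
have : nbhs (0 : R) ((cube_chart Q \o h) @^-1` solid_cube Q).
  by apply: ch; rewrite h0.
move=> /nbhs_ballP[e /= e0 he].
have inside s : `|s| < e -> 0 <= cube_coord v 0 j + s <= 1.
  move=> se; have /solid_cubeP/(_ j) : solid_cube Q ((cube_chart Q \o h) s).
    by apply: he; rewrite -ball_normE /= sub0r normrN.
  by rewrite /= cube_chartK hj.
have e2 : `|e / 2| < e by rewrite gtr0_norm; lra.
have e2' : `|- (e / 2)| < e by rewrite normrN.
have := inside _ e2; have := inside _ e2'.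
by case/orP: vj => /eqP ->; lra.
Unshelve. all: by end_near.
Qed.

Lemma face_relintP f v : face_relint Q f v <->
  cube_coord v 0 f.1 = (f.2 : nat)%:R /\
  forall j, j != f.1 -> 0 < cube_coord v 0 j < 1.
Proof.
split=> [[u [uf u01] <-]|[vf v01]]; first by rewrite cube_chartK.
by exists (cube_coord v); rewrite ?cube_coordK.
Qed.

End CubeChart.

(** * From shortest paths on a cube to shortest curves in coordinates *)

Section Transfer.
Set Implicit Arguments.
Unset Strict Implicit.
Context {R : realType}.
Implicit Types (Q : cube R) (g h : R -> 'rV[R]_3) (u v S T : 'rV[R]_3) (i j k : 'I_3).

Lemma poly_sum_eq (d e : R -> R -> R) (a : R) (l : seq R) :
  (forall t t', 0 <= t <= 1 -> 0 <= t' <= 1 -> d t t' = e t t') ->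
  0 <= a -> path <=%O a l -> last a l <= 1 -> poly_sum d a l = poly_sum e a l.
Proof.
move=> de; elim: l a => //= b l IH a a0 /andP[ab bl] l1.
have b0 := le_trans a0 ab; have b1 := le_trans (path_le_last bl) l1.
by rewrite IH // de //; lra.
Qed.

Lemma poly_sumZ (d : R -> R -> R) (c a : R) (l : seq R) :
  poly_sum (fun t t' => c * d t t') a l = c * poly_sum d a l.
Proof. by elim: l a => [|b l IH] a /=; rewrite ?mulr0 // IH mulrDr. Qed.

(** A numbering of the axes in which any chosen index [k] can play the role of z. *)
Definition axes i j k := [&& i != j, i != k, j != k &
  [forall l : 'I_3, [|| l == i, l == j | l == k]]].

Lemma axesP k : exists i j, axes i j k.
Proof.
case: k => -[|[|[|//]]] k3.
- exists (@Ordinal 3 1 isT), (@Ordinal 3 2 isT).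
  by rewrite /axes; apply/and4P; split=> //; apply/forallP => -[[|[|[|//]]] l3].
- exists (@Ordinal 3 0 isT), (@Ordinal 3 2 isT).
  by rewrite /axes; apply/and4P; split=> //; apply/forallP => -[[|[|[|//]]] l3].
exists (@Ordinal 3 0 isT), (@Ordinal 3 1 isT).
by rewrite /axes; apply/and4P; split=> //; apply/forallP => -[[|[|[|//]]] l3].
Qed.

Lemma axes_swap i j k : axes i j k -> axes j i k.
Proof.
case/and4P=> ij ik jk /forallP h; rewrite /axes eq_sym ij ik jk /=.
by apply/forallP => l; rewrite orbCA.
Qed.

Lemma big_axes (V : Type) (idx : V) (op : Monoid.com_law idx) (f : 'I_3 -> V) i j k :
  axes i j k -> \big[op/idx]_l f l = op (op (f i) (f j)) (f k).
Proof.
move=> /and4P[ij ik jk /forallP all_axes].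
rewrite (bigD1 i) //= (bigD1 j) 1?eq_sym //= (bigD1 k) /=; last first.
  by rewrite ![k == _]eq_sym ik jk.
rewrite big1 ?Monoid.mulm1 ?Monoid.mulmA // => l /andP[/andP[li lj] lk].
by have := all_axes l; rewrite (negPf li) (negPf lj) (negPf lk).
Qed.

Lemma edist_norm3 u v i j k : axes i j k ->
  Defs.edist u v = norm3 (u 0 i - v 0 i) (u 0 j - v 0 j) (u 0 k - v 0 k).
Proof. by move=> ijk; rewrite /Defs.edist (big_axes _ _ ijk). Qed.

(** The retraction of the line onto [0, 1]; composing with it extends a curve to all times. *)
Definition clamp (t : R) : R := Num.max (Num.min t 1) 0.

Lemma clamp_itv t : 0 <= clamp t <= 1.
Proof. by rewrite /clamp le_max ge_max ge_min !lexx ler01 !orbT. Qed.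

Lemma clamp_id t : 0 <= t <= 1 -> clamp t = t.
Proof. by case/andP=> t0 t1; rewrite /clamp min_l // max_l. Qed.

Lemma continuous_clamp (V : topologicalType) (g : R -> V) :
  {within `[0, 1], continuous g} -> continuous (g \o clamp).
Proof.
move=> /subspace_continuousP cg t.
have c01 : `[0, 1]%classic (clamp t) by rewrite /= in_itv /= clamp_itv.
apply: cvg_trans (cg _ c01) => A AA.
have cc : continuous clamp.
  apply: (@continuous_maxr _ (fun s => Num.min s 1)).
  by apply: (@continuous_minr _ id) => s; exact: cvg_id.
apply: (@filterS _ (nbhs t) (nbhs_filter t) _ _ _ (cc t _ AA)) => s /=; apply.
by rewrite /= in_itv /= clamp_itv.
Qed.

Definition coord_path Q g i (t : R) : R := cube_coord Q (g (clamp t)) 0 i.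

Lemma coord_pathE Q g i t : 0 <= t <= 1 -> coord_path Q g i t = cube_coord Q (g t) 0 i.
Proof. by move=> t01; rewrite /coord_path clamp_id. Qed.

Lemma surface_unit_surface Q v i j k : axes i j k ->
  cube_surface Q v <->
  unit_surface (cube_coord Q v 0 i) (cube_coord Q v 0 j) (cube_coord Q v 0 k).
Proof.
move=> /and4P[_ _ _ /forallP all_axes]; rewrite cube_surfaceP; split.
  move=> [v01 [l vl]]; rewrite /unit_surface !v01 /=.
  by case/or3P: (all_axes l) vl => /eqP -> ->; rewrite ?orbT.
case/and4P=> vi vj vk s; split; last by case/or3P: s => s; eexists; exact: s.
by move=> l; case/or3P: (all_axes l) => /eqP ->.
Qed.

(** The chart turns a competitor in coordinates into one on [Q] and multiplies all lengths by the
    side of [Q], which cancels in the comparison. *)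
Lemma shortest_path_coord Q S T g i j k : axes i j k -> shortest_path Q S T g ->
  coord_shortest (coord_path Q g i) (coord_path Q g j) (coord_path Q g k).
Proof.
move=> ijk [[cg gQ g0 g1] gmin].
have cpath l : continuous (coord_path Q g l).
  move=> t; apply: (@continuous_comp _ _ _ (g \o clamp) (fun v => cube_coord Q v 0 l)).
    exact: continuous_clamp.
  exact: continuous_cube_coord.
have s0 := cube_side_gt0 Q.
split.
  split; [exact: cpath..|].
  move=> t t01; rewrite /coord_path -surface_unit_surface //.
  by apply: gQ; rewrite in_itv /= clamp_itv.
move=> x y z [cx cy cz xyz] [x0 x1] [y0 y1] [z0 z1] M lM.
pose u t : 'rV[R]_3 := \row_l if l == i then x t else if l == j then y t else z t.
have /and4P[ij ik jk /forallP all_axes] := ijk.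
have ui t : u t 0 i = x t by rewrite mxE eqxx.
have uj t : u t 0 j = y t by rewrite mxE eq_sym (negPf ij) eqxx.
have uk t : u t 0 k = z t by rewrite mxE ![k == _]eq_sym (negPf ik) (negPf jk).
have ends t : 0 <= t <= 1 -> coord_path Q g i t = x t -> coord_path Q g j t = y t ->
    coord_path Q g k t = z t -> cube_chart Q (u t) = g t.
  move=> t01 ex ey ez; rewrite -[RHS](cube_coordK Q); congr (cube_chart Q _).
  apply/rowP => l; case/or3P: (all_axes l) => /eqP ->.
  - by rewrite ui -ex coord_pathE.
  - by rewrite uj -ey coord_pathE.
  - by rewrite uk -ez coord_pathE.
have [] : surface_curve Q S T (cube_chart Q \o u).
  split.
  - apply: continuous_subspaceT; apply: continuous_cube_chart => l.
    by case/or3P: (all_axes l) => /eqP ->;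
      [rewrite (funext ui)|rewrite (funext uj)|rewrite (funext uk)].
  - move=> t; rewrite in_itv /= => t01; apply/(surface_unit_surface _ _ ijk).
    by rewrite /= cube_chartK ui uj uk; exact: xyz.
  - by rewrite /= ends // lexx ler01.
  - by rewrite /= ends // lexx ler01.
move=> ch hQ h0 h1; have := gmin (cube_chart Q \o u).
move=> /(_ (And4 ch hQ h0 h1)) gh.
have hM : (curve_length (cube_chart Q \o u) <= (cube_side Q * M)%:E)%E.
  apply: ge_ereal_sup => _ [s s01 <-]; rewrite lee_fin polygon_length_poly_sum.
  have -> : (fun t t' => Defs.edist ((cube_chart Q \o u) t) ((cube_chart Q \o u) t')) =
      (fun t t' => cube_side Q * dist3 x y z t t').
    apply/funext => t; apply/funext => t'.
    by rewrite /= edist_chart (edist_norm3 _ _ ijk) !ui !uj !uk.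
  by rewrite poly_sumZ ler_pM2l //; exact: partition_length_le lM s01.
apply: length_le_partition; [exact: dist3xx|exact: dist3_ge0|].
move=> s s01; have := le_trans gh hM.
have : ((polygon_length g s)%:E <= curve_length g)%E.
  by apply: ereal_sup_ubound; exists s.
move=> /le_trans/[apply]; rewrite lee_fin polygon_length_poly_sum.
rewrite (@poly_sum_eq _ (fun t t' => cube_side Q *
    dist3 (coord_path Q g i) (coord_path Q g j) (coord_path Q g k) t t')) //.
- by rewrite poly_sumZ ler_pM2l.
- move=> t t' t01 t01'; rewrite -(cube_coordK Q (g t)) -(cube_coordK Q (g t')).
  by rewrite edist_chart (edist_norm3 _ _ ijk) /dist3 !coord_pathE.
- by case: s01 => s0' _; apply: sub_path s0' => a b /ltW.
- by case: s01 => _ /eqP ->.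
Qed.

Lemma traverses_lateral Q g i j k (b : bool) : axes i j k ->
  traverses Q g (i, b) <->
  meets_lateral (coord_path Q g i) (coord_path Q g j) (coord_path Q g k) (b : nat)%:R.
Proof.
move=> /and4P[ij ik jk /forallP all_axes]; split.
  move=> [t]; rewrite in_itv /= => t01 /face_relintP/= [ti tjk]; exists t.
  by rewrite !coord_pathE // !tjk // eq_sym.
move=> [t [t01]]; rewrite !coord_pathE // => ti tj tk.
exists t; rewrite ?in_itv //; apply/face_relintP; split=> // l /= li.
by case/or3P: (all_axes l) li => /eqP -> //; rewrite eqxx.
Qed.

Lemma meets_lateral_flip3 (x y z : R -> R) (a : R) :
  meets_lateral x y (fun t => 1 - z t) a <-> meets_lateral x y z a.
Proof. by split=> -[t [t01 xa yt zt]]; exists t; split=> //; lra. Qed.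

Lemma num_faces_traversedE Q g i j k : axes i j k ->
  num_faces_traversed Q g = (
    (`[<traverses Q g (i, true)>] + `[<traverses Q g (i, false)>]) +
    (`[<traverses Q g (j, true)>] + `[<traverses Q g (j, false)>]) +
    (`[<traverses Q g (k, true)>] + `[<traverses Q g (k, false)>]))%N.
Proof.
move=> ijk; pose F l b : nat := `[<traverses Q g (l, b)>].
rewrite -(big_axes addn (fun l => F l true + F l false)%N ijk).
rewrite -(eq_bigr _ (fun l _ => big_bool addn (F l))) pair_bigA.
rewrite /num_faces_traversed -sum1_card big_mkcond; apply: eq_bigr => -[l b] _ /=.
by rewrite inE /F; case: asboolP.
Qed.

End Transfer.

(** * Counting the traversed faces *)

Theorem mainTheorem1 (R : realType) (Q : cube R) (F G : cube_face)
    (S T : 'rV[R]_3) (FG : opposite_faces F G)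
    (SF : face_relint Q F S) (TG : face_relint Q G T)
    (g : R -> 'rV[R]_3) (sg : shortest_path Q S T g) :
  num_faces_traversed Q g = 3%N \/ num_faces_traversed Q g = 4%N.
Proof.
case: F FG SF => k b FG SF; case: G TG FG => k' b' TG; rewrite /opposite_faces /=.
case/andP => /eqP kk' bb'; subst k'.
have [i [j ijk]] := axesP k; have jik := axes_swap ijk.
have sh := shortest_path_coord ijk sg.
case: sg => -[_ _ g0 g1] _.
have i0 : 0 <= (0 : R) <= 1 by rewrite lexx ler01.
have i1 : 0 <= (1 : R) <= 1 by rewrite lexx ler01.
have trk : traverses Q g (k, b) by exists 0; rewrite ?in_itv // g0.
have trk' : traverses Q g (k, b') by exists 1; rewrite ?in_itv // g1.
set x := coord_path Q g i in sh *; set y := coord_path Q g j in sh *.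
set z := coord_path Q g k in sh *.
have [ends z0 z1] : [/\ [/\ 0 < x 0 < 1, 0 < y 0 < 1, 0 < x 1 < 1 & 0 < y 1 < 1],
    z 0 = (b : nat)%:R & z 1 = (b' : nat)%:R].
  have /and4P[_ ik jk _] := ijk.
  move/face_relintP: SF => /= [zS xyS]; move/face_relintP: TG => /= [zT xyT].
  by rewrite /x /y /z !coord_pathE // g0 g1 !xyS ?xyT.
(* The height is reversed if needed, so that it increases from 0 at [S] to 1 at [T]. *)
have [w osh wE] : exists2 w, opposite_shortest x y w &
    forall u v a, meets_lateral u v w a <-> meets_lateral u v z a.
  case: b b' bb' z0 z1 {SF TG trk trk'} => -[] // _ z0 z1.
    exists (fun t => 1 - z t); last by move=> u v a; exact: meets_lateral_flip3.
    by split; [exact: coord_shortest_flip3|rewrite z0 z1 subrr subr0].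
  by exists z.
have xP c : traverses Q g (i, c) <-> meets_lateral x y w (c : nat)%:R.
  by rewrite wE; exact: traverses_lateral.
have yP c : traverses Q g (j, c) <-> meets_lateral y x w (c : nat)%:R.
  by rewrite wE; exact: traverses_lateral.
have nx : ~ (traverses Q g (i, false) /\ traverses Q g (i, true)).
  by move=> [/xP m0 /xP m1]; exact: not_opposite_laterals osh m0 m1.
have ny : ~ (traverses Q g (j, false) /\ traverses Q g (j, true)).
  move=> [/yP m0 /yP m1].
  exact: not_opposite_laterals (opposite_shortest_swap osh) m0 m1.
have some : [\/ traverses Q g (i, false), traverses Q g (i, true),
    traverses Q g (j, false) | traverses Q g (j, true)].
  by case: (some_lateral osh) => m; [apply: Or41|apply: Or42|apply: Or43|apply: Or44];
    [apply/xP|apply/xP|apply/yP|apply/yP].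
rewrite (num_faces_traversedE Q g ijk).
have -> : `[<traverses Q g (k, true)>] = true.
  by apply/asboolP; case: b b' bb' trk trk' {z0 z1 SF TG} => -[].
have -> : `[<traverses Q g (k, false)>] = true.
  by apply/asboolP; case: b b' bb' trk trk' {z0 z1 SF TG} => -[].
(* The faces of [S] and [T] count two, each pair of opposite lateral faces at most one, and not both
   pairs zero. *)
case: asboolP => i1'; case: asboolP => i0'; case: asboolP => j1'; case: asboolP => j0';
  by [left|right|case: nx|case: ny|case: some].
Qed.
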